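(* Let $k\ge 3$ and let $\mathcal{L}=\{l_1,l_2,\dots,l_s\}$ be a set of $s$ nonnegative integers with $l_1<l_2<\dots<l_s$. If $\mathcal{A}=\{A_1,A_2,\dots,A_m\}$ is a family of (distinct) subsets of $[n]=\{1,\dots,n\}$ such that $|A_{i_1}\cap A_{i_2}\cap\dots\cap A_{i_k}|\in\mathcal{L}$ for every collection of $k$ distinct subsets $A_{i_1},\dots,A_{i_k}$ in $\mathcal{A}$, then there exists $n_0=n_0(k,s)$ such that for all $n\ge n_0$, \[ m\le \frac{k+s-1}{s+1}\binom{n-l_1}{s}+\sum_{i\le s-1}\binom{n-l_1}{i}. \]
   Context: $\binom{a}{b}$ denotes the usual binomial coefficient, equal to $0$ for $b<0$; the sum is over $0\le i\le s-1$.
   Formalization: The threshold n_0 may depend on l_1 as well as on k and s; with n_0(k,s) alone the claim fails (all (n-1)-subsets of [n], L={n-k}, s=1: m=n but the bound is k^2/2+1). *)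

(* Defs.v *)
From mathcomp Require Import all_boot all_order all_algebra.

Set Implicit Arguments.
Unset Strict Implicit.
Unset Printing Implicit Defensive.

(* A subfamily B of A with #|B| = k is a choice of k pairwise distinct members
   of A, so nothing is required of A when #|A| < k. *)
Definition kwise_intersecting (n k : nat) (L : seq nat)
    (A : {set {set 'I_n}}) : Prop :=
  forall B : {set {set 'I_n}},
    B \subset A -> #|B| = k -> #|\bigcap_(X in B) X| \in L.

(* Main.v *)
(** Let [n] be the size of the ground set [G].  A rank argument gives the crude
    bound [O(n^s)] with a constant depending on [k] and [s] only.

    Suppose no set of size [l1] lies in every member.  Then, as [k >= 3], any two
    members meet in more than [l1] points.  If some member [Y] has at most [n / q]
    points, grouping the others by their trace on [Y] (the traces are
    [(k-1)]-wise L-intersecting) gives [O(n^s / q)] members.  If all members are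
    larger, averaging yields an [(l1+1)]-set contained in a positive proportion of
    them; those avoid the size [l1], so there are only [O(n^(s-1))] members.

    Otherwise delete the common [l1]-set, so that [l1 = 0] and [n] becomes
    [n - l1].  If [L = {0, ..., s-1}], every s-set lies in at most [k - 1] members,
    while a member with more than [s] points contains at least [s + 1] s-sets; this
    count gives the bound exactly.  If some [l >= s] is in [L], members of size at
    most [l] number [O(n^(s-1))], members of size at least a constant [b] number
    [O(n^s / b)], and the remaining ones have at least [s + 1] points, so summing
    degrees and bounding each degree by induction on [s] gives
    [(k+s-2)/(s+1) * C(n,s)] up to lower order terms: a gain of [C(n,s)/(s+1)],
    which absorbs all the error terms. *)

Require Import Defs.
From mathcomp Require Import all_boot all_order all_algebra zify ring.

Set Implicit Arguments.
Unset Strict Implicit.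
Unset Printing Implicit Defensive.

Import Order.TTheory GRing.Theory Num.Theory.
Local Open Scope ring_scope.

(* Indexed, because distinct members may have equal traces. *)
Definition kwise (T I : finType) (F : I -> {set T}) (k : nat) (L : seq nat)
    (A : {set I}) : Prop :=
  forall B : {set I}, B \subset A -> #|B| = k -> #|\bigcap_(i in B) F i| \in L.

(** * Rank bound for triangular systems of pairs *)

(** The matrix [M] with entries $\prod_t(|B_i\cap C_j|-l_t)$ is triangular with nonzero diagonal, so
    it has rank [N]. Each factor is a sum of $|G|+1$ products of a term in $i$ and a term in $j$, so
    expanding the product factors [M] through dimension $(|G|+1)^{|L|}$. *)
Lemma triangular_bound (T : finType) (G : {set T}) (L : seq nat) (N : nat)
    (B C : 'I_N -> {set T}) :
    (forall i, B i \subset G) -> (forall i, #|B i :&: C i| \notin L) ->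
    (forall i j : 'I_N, (i < j)%N -> #|B i :&: C j| \in L) ->
  (N <= #|G|.+1 ^ size L)%N.
Proof.
move=> BG BC_notin BC_in.
pose J := {ffun 'I_(size L) -> 'I_#|G|.+1}.
pose M : 'M[rat]_N :=
  \matrix_(i, j) \prod_(t < size L) (#|B i :&: C j|%:R - (nth 0%N L t)%:R).
(* Index [ord0] stands for the constant term $-l_t$ of a factor, every other index for a point of
   [G]. *)
pose u i (t : 'I_(size L)) (y : 'I_#|G|.+1) : rat :=
  if unlift ord0 y is Some z then (enum_val z \in B i)%:R else - (nth 0%N L t)%:R.
pose v j (y : 'I_#|G|.+1) : rat :=
  if unlift ord0 y is Some z then (enum_val z \in C j)%:R else 1.
pose U : 'M[rat]_(N, #|J|) := \matrix_(i, c) \prod_t u i t ((enum_val c : J) t).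
pose V : 'M[rat]_(#|J|, N) := \matrix_(c, j) \prod_t v j ((enum_val c : J) t).
have MUV : M = U *m V.
  apply/matrixP => i j; rewrite !mxE.
  transitivity (\sum_(f : J) \prod_t (u i t (f t) * v j (f t))); last first.
    rewrite (big_enum_val (A := J)) /=; apply: eq_bigr => c _.
    by rewrite !mxE big_split.
  rewrite -(bigA_distr_bigA (fun t y => u i t y * v j y)).
  apply: eq_bigr => t _; rewrite big_ord_recl {1}/u {1}/v unlift_none mulr1 addrC.
  congr (_ + _); rewrite -sum1_card natr_sum.
  transitivity (\sum_(x in G) ((x \in B i)%:R * (x \in C j)%:R : rat)); last first.
    by rewrite big_enum_val; apply: eq_bigr => z _; rewrite /u /v liftK.
  rewrite [RHS](big_setID (B i :&: C j)) /= [X in _ + X]big1 ?addr0.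
    have -> : G :&: (B i :&: C j) = B i :&: C j.
      by apply/setIidPr/(subset_trans (subsetIl _ _)).
    by apply: eq_bigr => x /setIP[-> ->]; rewrite mulr1.
  by move=> x; rewrite !inE; case: (x \in B i); case: (x \in C j);
    rewrite ?mul0r ?mulr0.
have Mtrig : is_trig_mx M.
  apply/is_trig_mxP => i j ltij; rewrite mxE; apply/eqP/prodf_eq0.
  have iL : (index #|B i :&: C j| L < size L)%N by rewrite index_mem BC_in.
  by exists (Ordinal iL) => //=; rewrite nth_index ?BC_in ?subrr.
have detM : \det M != 0.
  rewrite det_trig //; apply/prodf_neq0 => i _; rewrite mxE.
  apply/prodf_neq0 => t _; rewrite subr_eq0 eqr_nat.
  by apply: contraNneq (BC_notin i) => ->; apply: mem_nth.
have rankM : \rank M = N by apply: mxrank_unit; rewrite unitmxE unitfE.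
have := leq_trans (mxrankM_maxl U V) (rank_leq_col U).
by rewrite -MUV rankM card_ffun !card_ord.
Qed.

Local Open Scope nat_scope.

(** * Crude bound for k-wise intersecting families *)

Lemma kwise_sub (T I : finType) (F : I -> {set T}) k L (A B : {set I}) :
  B \subset A -> kwise F k L A -> kwise F k L B.
Proof. by move=> BA kA D DB; apply: kA; apply: subset_trans BA. Qed.

(** An intersection with at least [l] points would equal each of the sets intersected, against
    injectivity. *)
Lemma bigcap_card_lt (T I : finType) (F : I -> {set T}) l (B : {set I}) :
    {in B &, injective F} -> (forall i, i \in B -> #|F i| <= l) -> 1 < #|B| ->
  #|\bigcap_(i in B) F i| < l.
Proof.
move=> Finj Fl /card_gt1P[i [j [iB jB]]]; apply: contraNltn => le_l.
have FE h : h \in B -> F h = \bigcap_(i in B) F i.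
  move=> hB; apply/esym/eqP; rewrite eqEcard bigcap_inf //=.
  exact: leq_trans (Fl h hB) le_l.
by apply/eqP/Finj => //; rewrite (FE i) ?(FE j).
Qed.

(** For members of size exactly [l], this puts their own size outside the list, as
    [kwise_card_notin] requires. *)
Lemma kwise_filter_lt (T I : finType) (F : I -> {set T}) k L (A : {set I}) l :
    1 < k -> {in A &, injective F} -> (forall i, i \in A -> #|F i| <= l) ->
  kwise F k L A -> kwise F k [seq x <- L | x < l] A.
Proof.
move=> k1 Finj Fl kA B BA cB; rewrite mem_filter kA // andbT.
apply: bigcap_card_lt; rewrite ?cB //.
  by move=> i j iB jB; apply: Finj; apply: (subsetP BA).
by move=> i iB; apply/Fl/(subsetP BA).
Qed.

Lemma kwise_filter_ge (T I : finType) (F : I -> {set T}) k L (A : {set I})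
    (U : {set T}) :
    (forall i, i \in A -> U \subset F i) ->
  kwise F k L A -> kwise F k [seq x <- L | #|U| <= x] A.
Proof.
move=> UF kA B BA cB; rewrite mem_filter kA // andbT.
by apply/subset_leq_card/bigcapsP => i iB; apply/UF/(subsetP BA).
Qed.

(* A maximal subfamily [S] with [0 < #|S| < k] and [#|\bigcap S| \notin L]
   meets every other member in a size from [L]; peel off such [S] repeatedly. *)
Lemma kwise_pairs (T I : finType) (F : I -> {set T}) k L (A : {set I}) :
    1 < k -> kwise F k L A -> (forall i, i \in A -> #|F i| \notin L) ->
  exists p : seq ({set T} * I),
    [/\ #|A| <= k.-1 * size p,
        forall q, q \in p -> [/\ q.2 \in A, q.1 \subset F q.2 & #|q.1| \notin L]
      & pairwise (fun q r => #|q.1 :&: F r.2| \in L) p].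
Proof.
move=> k1; have [n] := ubnP #|A|; elim: n A => // n IHn A leAn kA FL.
have [->|[i iA]] := set_0Vmem A; first by exists [::]; rewrite cards0.
pose P (S : {set I}) := [&& S \subset A, #|S| < k & #|\bigcap_(i in S) F i| \notin L].
have Pi : P [set i] by rewrite /P sub1set iA cards1 k1 big_set1 FL.
have [S maxS iS] := maxset_exists Pi.
have /and3P[SA Sk SL] := maxsetp maxS; rewrite sub1set in iS.
have [||p [Ap pA pw]] := IHn (A :\: S) _ (kwise_sub (subsetDl A S) kA).
- rewrite -ltnS; apply: leq_trans leAn; rewrite ltnS; apply: proper_card.
  by rewrite properE subsetDl /=; apply/subsetPn; exists i; rewrite // inE iS.
- by move=> j /setDP[jA _]; apply: FL.
(* One pair stands for all of [S], which has fewer than [k] elements; hence the factor [k.-1]. *)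
exists ((\bigcap_(i in S) F i, i) :: p); split=> /=.
- rewrite mulnS -(cardsID S A) leq_add //; first last.
  by rewrite (setIidPr SA) -ltnS prednK // ltnW.
- move=> q; rewrite inE => /predU1P[-> /=|/pA[]]; first by split; rewrite ?bigcap_inf.
  by rewrite inE => /andP[_ ? ? ?].
- rewrite pw andbT; apply/allP => -[B j] /pA[/= /setDP[jA jS] _ _].
  have SjA : j |: S \subset A by rewrite subUset sub1set jA.
  have cSj : #|j |: S| = #|S|.+1 by rewrite cardsU1 jS.
  rewrite setIC -big_setU1 //.
  (* If [j |: S] has [k] elements, the hypothesis on [A] applies; if fewer, a size outside [L] would
     contradict the maximality of [S]. *)
  have [Sk'|kS] := ltnP #|S|.+1 k; last by apply: kA; rewrite // cSj; lia.
  apply: contraNT jS => Sj; suff <- : j |: S = S by rewrite setU11.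
  by apply: (maxsetsup maxS); rewrite ?subsetUr // /P SjA cSj Sk'.
Qed.

(** The pairs from [kwise_pairs] satisfy the rank bound: each first component lies inside its own
    partner, so the diagonal intersection is that component, of size outside [L]. *)
Lemma kwise_card_notin (T I : finType) (F : I -> {set T}) k L (A : {set I})
    (G : {set T}) :
    1 < k -> (forall i, i \in A -> F i \subset G) ->
    kwise F k L A -> (forall i, i \in A -> #|F i| \notin L) ->
  #|A| <= k.-1 * #|G|.+1 ^ size L.
Proof.
move=> k1 FG kA FL; have [p [leAp pA pw]] := kwise_pairs k1 kA FL.
apply: leq_trans leAp _; rewrite leq_mul2l; apply/orP; right.
have [->//|[[B0 i0] _]] : p = [::] \/ exists q, q \in p.
  by case: (p) => [|q r]; [left | right; exists q; rewrite mem_head].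
pose q (j : 'I_(size p)) := nth (B0, i0) p j.
have qp j : q j \in p by apply: mem_nth.
apply: (@triangular_bound _ G _ _ (fun j => (q j).1) (fun j => F (q j).2)).
- by move=> j; have [/FG ? /subset_trans-> //] := pA _ (qp j).
- by move=> j; have [_ /setIidPl-> ] := pA _ (qp j).
- by move=> i j ltij; have /(pairwiseP (B0, i0)) := pw; apply; rewrite ?inE.
Qed.

Lemma card_le_sum_fibers (I : finType) (A : {set I}) (f : I -> nat) (L : seq nat) :
  #|A| <= #|[set i in A | f i \notin L]| + \sum_(l <- L) #|[set i in A | f i == l]|.
Proof.
elim: L => [|l L IHL].
  by rewrite big_nil addn0 subset_leq_card //; apply/subsetP=> i; rewrite inE => ->.
apply: leq_trans IHL _; rewrite big_cons addnA leq_add2r.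
rewrite -cardsUI; apply: leq_trans (leq_addr _ _).
apply/subset_leq_card/subsetP => i.
by rewrite !inE; case: (i \in A); case: (f i == l); case: (f i \in L).
Qed.

Lemma size_filter_lt (L : seq nat) (l : nat) :
  l \in L -> size [seq x <- L | x < l] < size L.
Proof.
move=> lL; rewrite size_filter -(count_predC (fun x => x < l) L) -addn1 leq_add2l.
by rewrite -has_count; apply/hasP; exists l; rewrite //= ltnn.
Qed.

(** Members of size outside [L] are bounded directly, and those of size [l] in [L] after cutting [L]
    down to the values below [l]. *)
Lemma kwise_card (T : finType) (k : nat) (L : seq nat) (A : {set {set T}})
    (G : {set T}) :
    1 < k -> (forall X, X \in A -> X \subset G) -> kwise id k L A ->
  #|A| <= k * (size L).+1 * #|G|.+1 ^ size L.
Proof.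
move=> k1 AG kA; apply: leq_trans (card_le_sum_fibers A (fun X => #|X|) L) _.
rewrite mulnAC mulnS leq_add //.
  apply: leq_trans (kwise_card_notin (k := k) (L := L) (G := G) (F := id) k1 _ _ _) _.
  - by move=> X; rewrite inE => /andP[/AG].
  - by apply: kwise_sub kA; apply/subsetP => X; rewrite inE => /andP[].
  - by move=> X; rewrite inE => /andP[].
  - by rewrite leq_mul2r leq_pred orbT.
rewrite -iter_addn_0 -count_predT -big_const_seq big_seq [leqRHS]big_seq.
apply: leq_sum => l lL.
apply: leq_trans (kwise_card_notin (k := k) (L := [seq x <- L | x < l]) (G := G)
  (F := id) k1 _ _ _) _.
- by move=> X; rewrite inE => /andP[/AG].
- apply: kwise_filter_lt => //; first by move=> X; rewrite inE => /andP[_ /eqP->].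
  by apply: kwise_sub kA; apply/subsetP => X; rewrite inE => /andP[].
- by move=> X; rewrite inE => /andP[_ /eqP->]; rewrite mem_filter ltnn.
- by rewrite leq_mul ?leq_pred // leq_pexp2l // ltnW // size_filter_lt.
Qed.

Lemma kwise_card_le (T : finType) (k r : nat) (L : seq nat) (A : {set {set T}})
    (G : {set T}) :
    1 < k -> size L <= r -> (forall X, X \in A -> X \subset G) -> kwise id k L A ->
  #|A| <= k * r.+1 * #|G|.+1 ^ r.
Proof.
move=> k1 Lr AG kA; apply: leq_trans (kwise_card k1 AG kA) _.
by rewrite leq_mul // ?leq_mul // leq_pexp2l.
Qed.

(** * Families without a common set of size l1 *)

(** Choosing one index per image set turns [k] distinct sets into [k] distinct indices. *)
Lemma kwise_imset (T I : finType) (F : I -> {set T}) k L (A : {set I}) :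
  kwise F k L A -> kwise id k L (F @: A).
Proof.
move=> kA B BFA cB; have [B0|[X0 X0B]] := set_0Vmem B.
  have /kA : #|set0 : {set I}| = k by rewrite cards0 -cB B0 cards0.
  by rewrite B0 !big_set0; apply; apply: sub0set.
have /imsetP[i0 _ _] := subsetP BFA _ X0B.
pose g X := odflt i0 [pick i in A | F i == X].
have gP X : X \in B -> g X \in A /\ F (g X) = X.
  move=> /(subsetP BFA)/imsetP[i iA ->]; rewrite /g; case: pickP => /=.
    by move=> j /andP[jA /eqP].
  by move=> /(_ i); rewrite iA eqxx.
have gK : {in B &, injective g} by move=> X Y /gP[_ {2}<-] /gP[_ {2}<-] ->.
have := kA (g @: B); rewrite card_in_imset // big_imset //=.
rewrite (eq_bigr id) => [|X /gP[_ ->]//]; apply=> //.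
by apply/subsetP => _ /imsetP[X /gP[gXA _] ->].
Qed.

Lemma card_extend (I : finType) (A S : {set I}) (k : nat) :
  S \subset A -> #|S| <= k <= #|A| ->
  exists B : {set I}, [/\ S \subset B, B \subset A & #|B| = k].
Proof.
move=> SA /andP[Sk kA]; have := Sk; rewrite leq_eqVlt => /predU1P[<-|_].
  by exists S.
elim: k Sk kA => [|k IHk] Sk kA; first by exists S; split=> //; apply/eqP; rewrite -leqn0.
move: Sk; rewrite leq_eqVlt => /predU1P[Sk|]; first by exists S.
rewrite ltnS => /IHk[|B [SB BA cB]]; first exact: ltnW.
have /subsetPn[i iA iB] : ~~ (A \subset B).
  by apply: contraL kA => /subset_leq_card; rewrite cB -leqNgt.
exists (i |: B); rewrite subUset sub1set iA BA cardsU1 iB cB; split=> //.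
exact: subset_trans (subsetUr _ _).
Qed.

(** As $k\ge 3$, any three members extend to [k] members and so share at least [l1] points. If
    $X\cap Y$ had at most [l1] points, it would have exactly [l1] and lie in every member. *)
Lemma kwise_pair_gt (T : finType) (k l1 : nat) (L : seq nat) (A : {set {set T}}) :
    2 < k -> k <= #|A| -> (forall l, l \in L -> l1 <= l) -> kwise id k L A ->
    (forall D : {set T}, #|D| = l1 -> exists2 X, X \in A & ~~ (D \subset X)) ->
  forall X Y, X \in A -> Y \in A -> X != Y -> l1 < #|X :&: Y|.
Proof.
move=> k2 leA Ll kA nocore X Y XA YA XY; rewrite ltnNge; apply/negP => leXY.
have XYZ Z : Z \in A -> l1 <= #|X :&: Y :&: Z|.
  move=> ZA; have [||B [SB BA cB]] := @card_extend _ A [set X; Y; Z] k.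
  - by rewrite !subUset !sub1set XA YA ZA.
  - rewrite leA andbT; apply: leq_trans k2; rewrite -setUA cardsU1 -[3]/(1 + 2).
    by apply: leq_add; [apply: leq_b1 | rewrite cards2 ltnS leq_b1].
  apply: leq_trans (Ll _ (kA B BA cB)) _; apply: subset_leq_card.
  have inB W : W \in [set X; Y; Z] -> \bigcap_(V in B) V \subset W.
    by move=> WS; apply: bigcap_inf; apply: (subsetP SB).
  by rewrite !subsetI !inB // !inE eqxx ?orbT.
have cXY : #|X :&: Y| = l1.
  by apply/eqP; rewrite eqn_leq leXY; have := XYZ X XA; rewrite setIAC setIid.
have [Z ZA] := nocore _ cXY; rewrite -cXY in XYZ.
by move/negP; apply; apply/setIidPl/eqP; rewrite eqEcard subsetIl XYZ.
Qed.

Lemma double_count (I J : finType) (A : {set I}) (B : {set J}) (r : I -> J -> bool) :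
  \sum_(i in A) #|[set j in B | r i j]| = \sum_(j in B) #|[set i in A | r i j]|.
Proof.
transitivity (\sum_(i in A) \sum_(j in B) (r i j : nat)).
  apply: eq_bigr => i _; rewrite -sum1dep_card big_mkcondr /=.
  by apply: eq_bigr => j _; case: (r i j).
rewrite exchange_big; apply: eq_bigr => j _; rewrite -sum1dep_card big_mkcondr /=.
by apply: eq_bigr => i _; case: (r i j).
Qed.

(* Points are added to [U] one at a time, each time a point of maximal degree. *)
Lemma dense_subset (T : finType) (A : {set {set T}}) (G : {set T}) (q j : nat) :
    0 < #|G| -> A != set0 -> (forall X, X \in A -> X \subset G) ->
    (forall X, X \in A -> #|G| <= q * (#|X| - j)) ->
  exists2 U : {set T}, #|U| = j & #|A| <= q ^ j * #|[set X in A | U \subset X]|.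
Proof.
move=> G0 A0 AG Aj; have: j <= j by [].
elim: {1 3 4}j => [_|i IHi ltij].
  exists set0; rewrite ?cards0 // mul1n subset_leq_card //.
  by apply/subsetP => X XA; rewrite inE XA sub0set.
have {IHi}[U cU leA] := IHi (ltnW ltij).
set AU := [set X in A | U \subset X] in leA.
have AU0 : 0 < #|AU| by rewrite -card_gt0 in A0; lia.
have [/existsP[x /andP[xU lex]]|] :=
  boolP [exists x, (x \notin U) && (#|AU| <= q * #|[set X in AU | x \in X]|)].
  exists (x |: U); first by rewrite cardsU1 xU cU.
  apply: leq_trans leA _; rewrite expnSr -mulnA leq_mul2l; apply/orP; right.
  apply: leq_trans lex _; rewrite leq_mul2l; apply/orP; right.
  by apply/subset_leq_card/subsetP => X; rewrite !inE subUset sub1set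
    => /andP[/andP[-> ->] ->].
(* Averaging: if every point outside [U] had degree below $|AU|/q$, the incidences would number
   fewer than $|AU||G|/q$, yet each member of [AU] has at least $|G|/q$ points outside [U]. *)
rewrite negb_exists => /forallP small; exfalso.
have := double_count AU (G :\: U) (fun X x => x \in X).
move/(congr1 (muln q)); apply/eqP; rewrite gtn_eqF // !big_distrr /=.
apply: (@leq_ltn_trans (#|G :\: U| * #|AU|.-1)).
  rewrite -sum_nat_const; apply: leq_sum => x /setDP[_ xU].
  by have := small x; rewrite xU /= -ltnNge; case: #|AU|.
apply: (@leq_trans (#|AU| * #|G|)).
  rewrite mulnC; have := subset_leq_card (subsetDl G U); nia.
rewrite -sum_nat_const; apply: leq_sum => X; rewrite inE => /andP[XA UX].
apply: leq_trans (Aj X XA) _; rewrite leq_mul2l; apply/orP; right.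
have -> : [set x in G :\: U | x \in X] = X :\: U.
  apply/setP => x; rewrite !inE -andbA; congr (_ && _).
  by case xX: (x \in X); rewrite ?andbF // (subsetP (AG X XA)).
by rewrite cardsD (setIidPr UX) cU leq_sub2l // ltnW.
Qed.

Lemma kwise_trace (T : finType) (k : nat) (L : seq nat) (A : {set {set T}})
    (Y : {set T}) :
    1 < k -> Y \in A -> kwise id k L A ->
  kwise (fun X => Y :&: X) k.-1 L (A :\ Y).
Proof.
move=> k1 YA kA B BA cB.
have YB : Y \notin B by apply/negP => /(subsetP BA); rewrite !inE eqxx.
have /kA : Y |: B \subset A.
  by rewrite subUset sub1set YA (subset_trans BA) // subD1set.
rewrite cardsU1 YB cB add1n prednK ?(ltnW k1) // => /(_ erefl).
suff -> : \bigcap_(X in Y |: B) X = \bigcap_(X in B) (Y :&: X) by [].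
have [X0 X0B] : exists X, X \in B by apply/set0Pn; rewrite -card_gt0 cB; lia.
rewrite big_setU1 //=; apply/setP => x; rewrite inE; apply/andP/bigcapP.
  by move=> [xY /bigcapP xB] X XB; rewrite inE xY xB.
move=> xB; split; first by have /setIP[] := xB _ X0B.
by apply/bigcapP => X /xB /setIP[].
Qed.

(** Let $i$ count the entries of [L] below [l]. The traces of size [l] are $(k-1)$-wise intersecting
    with only these $i$ sizes, since $k-1\ge 2$. Members with a common trace [Z] all contain [Z],
    which leaves only the other $|L|-i$ sizes. *)
Lemma card_trace_fiber (T : finType) (k l : nat) (L : seq nat) (A : {set {set T}})
    (G Y : {set T}) :
    2 < k -> Y \in A -> (forall X, X \in A -> X \subset G) -> kwise id k L A ->
  #|[set X in A :\ Y | #|Y :&: X| == l]| <=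
    (k * #|Y|.+1 ^ size [seq x <- L | x < l]) *
    (k * (size L).+1 * #|G|.+1 ^ (size L - size [seq x <- L | x < l])).
Proof.
move=> k2 YA AG kA; set i := size [seq _ <- _ | _]; set Al := [set X in _ | _].
pose F X := Y :&: X.
have kF : kwise F k.-1 L Al.
  apply: kwise_sub (kwise_trace (ltnW k2) YA kA).
  by apply/subsetP => X; rewrite inE => /andP[].
have cFl Z : Z \in F @: Al -> #|Z| = l.
  by move=> /imsetP[X]; rewrite inE => /andP[_ /eqP XY] ->.
have k1 : 1 < k.-1 by rewrite -subn1 ltn_subRL.
have leF : #|F @: Al| <= k * #|Y|.+1 ^ i.
  have leFl : (forall Z, Z \in F @: Al -> #|Z| <= l) by move=> Z /cFl->.
  have := kwise_card_notin (G := Y) (F := id) k1 _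
    (kwise_filter_lt (F := id) k1 (in2W (fun X Y => id)) leFl (kwise_imset kF)) _.
  move=> /(_ _ _)/leq_trans; apply.
  - by move=> _ /imsetP[X _ ->]; apply: subsetIl.
  - by move=> Z /cFl->; rewrite mem_filter ltnn.
  - by rewrite leq_mul2r; apply/orP; right; lia.
rewrite -sum1_card (partition_big_imset F) /=.
apply: leq_trans (leq_mul leF (leqnn _)); rewrite -sum_nat_const.
apply: leq_sum => Z ZF; rewrite sum1dep_card.
set B := [set _ | _].
have BA : B \subset A by apply/subsetP => X; rewrite !inE => /andP[/andP[/andP[]]].
have BZ X : X \in B -> Z \subset X.
  by rewrite inE => /andP[_ /eqP <-]; apply: subsetIr.
have BG X : X \in B -> X \subset G by move=> /(subsetP BA)/AG.
have szE : size [seq x <- L | #|Z| <= x] = size L - i.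
  rewrite (cFl Z ZF) /i -(count_predC (fun x => x < l) L) !size_filter addKn.
  by apply: eq_count => x /=; rewrite leqNgt.
have := kwise_card (ltnW k2) BG (kwise_filter_ge BZ (kwise_sub BA kA)).
rewrite szE => /leq_trans; apply; rewrite leq_mul2r; apply/orP; right.
by rewrite leq_mul2l ltnS leq_subr orbT.
Qed.

Lemma card_of_small_member (T : finType) (k l1 q : nat) (L : seq nat)
    (A : {set {set T}}) (G Y : {set T}) :
    2 < k -> Y \in A -> (forall X, X \in A -> X \subset G) -> kwise id k L A ->
    l1 \in L -> (forall X, X \in A -> Y != X -> l1 < #|Y :&: X|) ->
    q * #|Y|.+1 <= #|G|.+1 ->
  q * #|A| <= q + (k * (size L).+1) ^ 2 * #|G|.+1 ^ size L.
Proof.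
move=> k2 YA AG kA l1L Yl1 qY; set s := size L; set n1 := #|G|.+1 in qY *.
have Yn : #|Y|.+1 <= n1 by rewrite ltnS subset_leq_card ?AG.
have qYi i : 0 < i -> q * #|Y|.+1 ^ i <= n1 ^ i.
  case: i => [|[|i]] // _.
  by rewrite expnS [leqRHS]expnS mulnA leq_mul // leq_exp2r.
have s0 : 0 < s by rewrite /s; case: (L) l1L.
rewrite (cardsD1 Y) YA mulnDr muln1 leq_add2l.
apply: leq_trans (leq_mul (leqnn q) (card_le_sum_fibers _ (fun X => #|Y :&: X|) L)) _.
rewrite mulnDr big_distrr /=.
have notin_le : q * #|[set X in A :\ Y | #|Y :&: X| \notin L]| <= k * n1 ^ s.
  have k1 : 1 < k.-1 by rewrite -subn1 ltn_subRL.
  set A' := [set _ in _ | _].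
  have A'A : A' \subset A :\ Y by apply/subsetP => X; rewrite inE => /andP[].
  have := kwise_card_notin (G := Y) k1 (fun X _ => subsetIl Y X)
    (kwise_sub A'A (kwise_trace (ltnW k2) YA kA)).
  move=> /(_ _)/(leq_mul (leqnn q))/leq_trans; apply.
    by move=> X; rewrite inE => /andP[].
  by rewrite mulnCA; apply: leq_mul; [lia | apply: qYi].
apply: leq_trans (leq_add notin_le (_ : _ <= s * (k * (k * s.+1) * n1 ^ s))) _; last first.
  have : k * 1 <= k * (k * s.+1) by rewrite leq_mul2l muln_gt0; lia.
  rewrite expnS expn1; move: (n1 ^ s) => N; nia.
rewrite [leqRHS]mulnC -[X in _ <= _ * X]/(size L) -iter_addn_0 -count_predT.
rewrite -big_const_seq big_seq [leqRHS]big_seq; apply: leq_sum => l lL.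
have [->|[X]] := set_0Vmem [set X in A :\ Y | #|Y :&: X| == l].
  by rewrite cards0 muln0.
rewrite !inE => /andP[/andP[XY XA] /eqP cYX].
apply: leq_trans (leq_mul (leqnn q) (card_trace_fiber l k2 YA AG kA)) _.
set i := size _.
(* The value [l1] lies below [l], so the power of $|Y|+1$ is at least the first and gains the factor
   [q]. *)
have i0 : 0 < i.
  rewrite /i size_filter -has_count; apply/hasP; exists l1 => //=.
  by rewrite -cYX Yl1 // eq_sym.
have si : i <= s by rewrite /i size_filter count_size.
have := qYi i i0; rewrite -{2}(subnK si) expnD -/s -/n1.
move: (n1 ^ i) (n1 ^ (s - i)) (#|Y|.+1 ^ i) => N M y le.
have -> : q * (k * y * (k * s.+1 * M)) = k * (k * s.+1) * (M * (q * y)) by ring.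
by rewrite !leq_mul.
Qed.

(** Factor by factor, $n+1\le 4(n-l-i)$ for $i<s$. This turns bounds by powers into bounds by
    binomial coefficients. *)
Lemma expn_le_bin (n l s : nat) :
  2 * (l + s) <= n -> n.+1 ^ s <= 4 ^ s * s`! * 'C(n - l, s).
Proof.
move=> ln; rewrite -mulnA [s`! * _]mulnC bin_ffact ffact_prod.
rewrite -[in n.+1 ^ s](card_ord s) -[in 4 ^ s](card_ord s) -!prod_nat_const.
by rewrite -big_split /=; apply: leq_prod => i _; have := ltn_ord i; lia.
Qed.

Lemma no_core_card (k s l1 : nat) :
    2 < k -> 0 < s ->
  exists n0, forall (T : finType) (G : {set T}) (L : seq nat) (A : {set {set T}}),
    n0 <= #|G| -> size L = s -> l1 \in L -> (forall l, l \in L -> l1 <= l) ->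
    (forall X, X \in A -> X \subset G) -> kwise id k L A ->
    (forall D : {set T}, #|D| = l1 -> exists2 X, X \in A & ~~ (D \subset X)) ->
  #|A| <= 'C(#|G| - l1, s).
Proof.
(* With $q=2KQ$, one member of at most about $n/q$ points forces $|A|\le 1+C/2$, where
   $C=\binom{n-l_1}{s}$. *)
move=> k2 s0; set Q := 4 ^ s * s`!; set K := (k * s.+1) ^ 2; set q := 2 * (K * Q).
have K0 : 0 < K by rewrite expn_gt0 muln_gt0; lia.
have Q0 : 0 < Q by rewrite muln_gt0 expn_gt0 fact_gt0.
have q0 : 0 < q by rewrite /q muln_gt0 /= muln_gt0 K0.
(* In order, the summands allow [expn_le_bin], let large members lose [l1.+1] points, give $k\le C$,
   and beat the constants of the dense case. *)
exists (2 * (l1 + s) + 2 * q * l1.+2 + k * Q + (2 * q) ^ l1.+1 * (k * s) * Q).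
move=> T G L A leG Ls l1L Ll1 AG kA nocore; set n := #|G| in leG *.
have leG' : 2 * (q * l1.+2) <= n.
  by apply: leq_trans leG; rewrite mulnA -2!addnA (leq_trans (leq_addr _ _) (leq_addl _ _)).
have leC : n.+1 ^ s <= Q * 'C(n - l1, s) by apply: expn_le_bin; lia.
set C := 'C(_, _) in leC *.
have kC : k <= C.
  rewrite -(leq_pmul2l Q0) mulnC; apply: leq_trans leC.
  by apply: leq_trans (leq_pexp2l _ s0); lia.
have [leA|/ltnW leA] := leqP k #|A|; last exact: leq_trans kC.
have [X0 X0A] : exists X, X \in A by apply/set0Pn; rewrite -card_gt0; lia.
have pair_gt := kwise_pair_gt k2 leA Ll1 kA nocore.
have [/existsP[Y /andP[YA leY]]|] := boolP [exists Y in A, q * #|Y|.+1 <= n.+1].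
  have := card_of_small_member k2 YA AG kA l1L (fun X XA => pair_gt Y X YA XA) leY.
  rewrite Ls -/K => leqA.
  have : 2 * (q * #|A|) <= q * (2 + C).
    rewrite mulnDr; apply: leq_trans (leq_mul (leqnn 2) leqA) _.
    rewrite mulnDr [q * 2]mulnC leq_add2l /q -!mulnA !leq_mul2l.
    by rewrite [_ <= _](_ : _ = true) ?orbT // mulnA.
  by rewrite mulnCA leq_pmul2l //; lia.
rewrite negb_exists_in => /forall_inP big_members.
have bigA X : X \in A -> n <= 2 * q * (#|X| - l1.+1).
  move=> /big_members; rewrite -ltnNge mulnS -mulnA mulnBr.
  by move: leG'; rewrite mulnS; move: (q * #|X|) (q * l1.+1) => a b; clearbody q; lia.
have A0 : A != set0 by apply/set0Pn; exists X0.
have G0 : 0 < #|G| by apply: leq_trans leG'; rewrite muln_gt0 /= muln_gt0 q0.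
have [U cU leAU] := dense_subset G0 A0 AG bigA.
set AU := [set _ in _ | _] in leAU.
have AUA : AU \subset A by apply/subsetP => X; rewrite inE => /andP[].
have AUU X : X \in AU -> U \subset X by rewrite inE => /andP[].
(* Members containing [U] meet in more than [l1] points, so [l1] drops out of the list and a factor
   $n+1$ is saved. *)
have szU : size [seq x <- L | #|U| <= x] <= s.-1.
  rewrite -ltnS prednK // -Ls cU size_filter -(count_predC (fun x => l1 < x) L).
  rewrite -addn1 leq_add2l -has_count; apply/hasP; exists l1 => //=.
  by rewrite ltnn.
have := kwise_card_le (ltnW k2) szU (fun X XA => AG X (subsetP AUA X XA))
  (kwise_filter_ge AUU (kwise_sub AUA kA)).
rewrite prednK // -/n => leAUn.
have : n.+1 * #|A| <= n.+1 * C; last by rewrite leq_pmul2l.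
have := leq_mul leAU (leqnn n.+1); rewrite mulnC => /leq_trans; apply.
rewrite -mulnA; apply: leq_trans (leq_mul (leqnn _) (leq_mul leAUn (leqnn _))) _.
rewrite -[_ * _ * n.+1]mulnA -expnSr prednK //.
rewrite mulnA; apply: leq_trans (leq_mul (leqnn _) leC) _.
by rewrite mulnA leq_mul //; apply: leqW; apply: leq_trans leG; rewrite leq_addl.
Qed.

(** * Deleting a common set, and lists with all values below s *)

(** The intersection contains [D], so deleting [D] lowers its size by exactly [#|D|]. This serves
    both the common set of size [l1] and the link of a single point. *)
Lemma kwise_link (T : finType) (k : nat) (L L' : seq nat) (A : {set {set T}})
    (D : {set T}) :
    0 < k -> (forall X, X \in A -> D \subset X) ->
    (forall l, l \in L -> #|D| <= l -> l - #|D| \in L') -> kwise id k L A ->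
  kwise id k L' [set X :\: D | X in A].
Proof.
move=> k0 AD LL' kA; apply: kwise_imset => B BA cB.
have DB : D \subset \bigcap_(X in B) X.
  by apply/bigcapsP => X /(subsetP BA)/AD.
suff -> : \bigcap_(X in B) (X :\: D) = (\bigcap_(X in B) X) :\: D.
  by rewrite cardsD (setIidPr DB) LL' ?kA // subset_leq_card.
have [X0 X0B] : exists X, X \in B by apply/set0Pn; rewrite -card_gt0 cB.
apply/setP => x; rewrite inE; apply/bigcapP/andP.
  move=> xB; split; first by have /setDP[] := xB _ X0B.
  by apply/bigcapP => X /xB/setDP[].
by move=> [xD /bigcapP xB] X XB; rewrite inE xD xB.
Qed.

Lemma card_link (T : finType) (A : {set {set T}}) (D : {set T}) :
  (forall X, X \in A -> D \subset X) -> #|[set X :\: D | X in A]| = #|A|.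
Proof.
move=> AD; rewrite card_in_imset // => X Y /AD DX /AD DY XY.
by rewrite -(setID X D) -(setID Y D) XY (setIidPr DX) (setIidPr DY).
Qed.

Lemma card_small_members (T : finType) (A : {set {set T}}) (G : {set T}) (s : nat) :
    (forall X, X \in A -> X \subset G) -> (forall X, X \in A -> #|X| < s) ->
  #|A| <= \sum_(i < s) 'C(#|G|, i).
Proof.
move=> AG As; apply: leq_trans (card_le_sum_fibers A (fun X => #|X|) (index_iota 0 s)) _.
rewrite [X in X + _]eq_card0 ?add0n => [|X]; last first.
  by rewrite !inE mem_index_iota; case XA: (X \in A); rewrite //= As.
rewrite big_mkord; apply: leq_sum => i _; rewrite -cards_draws.
by apply/subset_leq_card/subsetP => X; rewrite !inE => /andP[/AG-> ->].
Qed.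

(** Count pairs of an s-set inside a member. An s-set lies in at most $k-1$ members, as [k] members
    above it would meet in at least [s] points; a member of size [s] contains one s-set, a larger
    one at least $s+1$. *)
Lemma card_interval (T : finType) (k s : nat) (L : seq nat) (A : {set {set T}})
    (G : {set T}) :
    0 < k -> (forall l, l \in L -> l < s) -> (forall X, X \in A -> X \subset G) ->
    kwise id k L A ->
  s.+1 * #|A| <= (k + s - 1) * 'C(#|G|, s) + s.+1 * \sum_(i < s) 'C(#|G|, i).
Proof.
move=> k0 Ls AG kA; set n := #|G|.
pose A1 := [set X in A | #|X| < s]; pose A2 := [set X in A | #|X| == s].
pose A3 := [set X in A | s < #|X|].
have cA : #|A| <= #|A1| + #|A2| + #|A3|.
  apply: (@leq_trans #|A1 :|: A2 :|: A3|); last first.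
    by have := cardsUI (A1 :|: A2) A3; have := cardsUI A1 A2; lia.
  by apply/subset_leq_card/subsetP => X XA; rewrite !inE XA /=; case: ltngtP.
have cA1 : #|A1| <= \sum_(i < s) 'C(n, i).
  by apply: card_small_members => X; rewrite inE => /andP[// /AG].
have cA2 : #|A2| <= 'C(n, s).
  rewrite -cards_draws; apply/subset_leq_card/subsetP => X.
  by rewrite !inE => /andP[/AG-> ->].
have cA23 : #|A2| + s.+1 * #|A3| <= (k - 1) * 'C(n, s).
  pose B := [set S : {set T} | S \subset G & #|S| == s].
  have := double_count A B (fun X S => S \subset X).
  have leB : \sum_(S in B) #|[set X in A | S \subset X]| <= (k - 1) * 'C(n, s).
    rewrite mulnC -cards_draws -sum_nat_const; apply: leq_sum => S.
    rewrite inE => /andP[_ /eqP cS]; rewrite -ltnS subn1 prednK // ltnNge.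
    apply/negP => leS; have [|D [_ DA cD]] :=
      @card_extend _ [set X in A | S \subset X] set0 k (sub0set _).
      by rewrite cards0 leS.
    have DA' : D \subset A.
      by apply: subset_trans DA _; apply/subsetP => X; rewrite inE => /andP[].
    have := Ls _ (kA D DA' cD); rewrite ltnNge -cS => /negP; apply.
    apply/subset_leq_card/bigcapsP => X /(subsetP DA).
    by rewrite inE => /andP[].
  move=> eqB; apply: leq_trans leB; rewrite -eqB.
  have cB X : X \in A -> #|[set S in B | S \subset X]| = 'C(#|X|, s).
    move=> XA; rewrite -cards_draws; apply: eq_card => S; rewrite !inE.
    case SX: (S \subset X); rewrite ?andbF ?andbT //=.
    by rewrite (subset_trans SX (AG X XA)).
  have cE (P : pred {set T}) : #|[set X in A | P X]| = \sum_(X in A) (P X : nat).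
    by rewrite -sum1dep_card big_mkcondr; apply: eq_bigr => X _; case: (P X).
  rewrite !cE big_distrr -big_split /=; apply: leq_sum => X XA; rewrite cB //.
  case: ltngtP => [ltXs|ltsX|->]; rewrite ?muln0 ?binn //.
  by rewrite add0n muln1 -[s.+1]binSn leq_bin2l.
apply: leq_trans (leq_mul (leqnn _) cA) _; rewrite -addnA mulnDr addnC leq_add //.
  (* Adding $s|A_2|\le s\binom{n}{s}$ raises the weight of the members of size [s] from 1 to
     $s+1$. *)
  have -> : k + s - 1 = (k - 1) + s by lia.
  rewrite mulnDl; apply: leq_trans (leq_add cA23 (leq_mul (leqnn s) cA2)).
  by rewrite mulnDr mulSn addnAC.
by rewrite leq_mul.
Qed.

(** * Lists with a value at least s *)

Lemma head_leq (L : seq nat) (l : nat) : sorted ltn L -> l \in L -> head 0 L <= l.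
Proof.
case: L => // a L /= /(order_path_min ltn_trans)/allP aL.
by rewrite inE => /predU1P[->//|/aL/ltnW].
Qed.

Lemma leq_bin_exp (n m : nat) : 'C(n, m) <= n ^ m.
Proof.
apply: (@leq_trans ('C(n, m) * m`!)); first by rewrite leq_pmulr ?fact_gt0.
rewrite bin_ffact ffact_prod -[in n ^ m](card_ord m) -prod_nat_const.
by apply: leq_prod => i _; apply: leq_subr.
Qed.

Lemma leq_sum_bin (n m r : nat) : n <= m -> \sum_(i < r) 'C(n, i) <= r * m.+1 ^ r.-1.
Proof.
move=> nm; rewrite -[X in X * _](card_ord r) -sum_nat_const; apply: leq_sum => i _.
apply: leq_trans (leq_bin2l i (leqW nm)) _; apply: leq_trans (leq_bin_exp _ _) _.
by apply: leq_pexp2l; have := ltn_ord i; lia.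
Qed.

(** Cleared of the denominator $s+1$. The ground set is any finite set [G], so that the induction
    can pass to links, and the threshold is independent of [G] and of the rest of [L]. *)
Definition card_bound_eventually (k s l1 : nat) : Prop :=
  exists n0, forall (T : finType) (G : {set T}) (L : seq nat) (A : {set {set T}}),
    n0 <= #|G| -> sorted ltn L -> size L = s -> head 0 L = l1 ->
    (forall X, X \in A -> X \subset G) -> kwise id k L A ->
  s.+1 * #|A| <= (k + s - 1) * 'C(#|G| - l1, s)
                 + s.+1 * \sum_(i < s) 'C(#|G| - l1, i).

(** The links of points have varying least sizes, all below a constant; one threshold must serve
    them all. *)
Lemma exists_uniform_threshold (P : nat -> nat -> Prop) (b : nat) :
    (forall l, exists n0, forall n, n0 <= n -> P l n) ->
  exists n0, forall l n, l < b -> n0 <= n -> P l n.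
Proof.
move=> Pev; elim: b => [|b [n0 IHb]]; first by exists 0.
have [n1 Pb] := Pev b; exists (n0 + n1) => l n.
rewrite ltnS leq_eqVlt => /predU1P[-> ln|lb ln]; first by apply: Pb; lia.
by apply: IHb => //; lia.
Qed.

Lemma sorted_map_sub (L : seq nat) (d : nat) :
  all (leq d) L -> sorted ltn L -> sorted ltn [seq l - d | l <- L].
Proof.
apply: homo_sorted_in => x y dx _ xy; apply: ltn_sub2r => //.
exact: leq_ltn_trans dx xy.
Qed.

Lemma mul_card_le_degrees (T : finType) (A : {set {set T}}) (G : {set T})
    (a w c : nat) :
    (forall X, X \in A -> X \subset G) -> (forall X, X \in A -> a <= #|X|) ->
    (forall x, x \in G -> w * #|[set X in A | x \in X]| <= c) ->
  w * (a * #|A|) <= #|G| * c.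
Proof.
move=> AG Aa degc; rewrite -[leqRHS]sum_nat_const.
apply: (@leq_trans (\sum_(x in G) w * #|[set X in A | x \in X]|)); last exact: leq_sum.
rewrite -big_distrr leq_mul //= -(double_count A G (fun X x => x \in X)).
rewrite mulnC -sum_nat_const; apply: leq_sum => X XA.
apply: leq_trans (Aa X XA) _; apply/subset_leq_card/subsetP => x xX.
by rewrite inE xX (subsetP (AG X XA)).
Qed.

Lemma card_not_interval (k r : nat) :
    2 < k -> (0 < r -> forall l1, card_bound_eventually k r l1) ->
  exists n0, forall (T : finType) (G : {set T}) (L : seq nat) (A : {set {set T}}),
    n0 <= #|G| -> sorted ltn L -> size L = r.+1 -> head 0 L = 0 ->
    (exists2 l, l \in L & r < l) ->
    (forall X, X \in A -> X \subset G) -> kwise id k L A ->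
  r.+2 * #|A| <= (k + r) * 'C(#|G|, r.+1).
Proof.
move=> k2 IHr; have [r0|r0] := posnP r.
  exists 0 => T G [|a [|b L]] A _ //= _; rewrite r0 //= => _ -> [l].
  by rewrite inE => /eqP->.
(* [b] makes the members of size at least [b] cost at most $C/2$; [W] does the same for all terms of
   order $n^r$. *)
set Q := 4 ^ r.+1 * r.+1`!; set K := k * r.+1; pose b := 2 * (r.+2 * (K * Q)).
pose W := 2 * (r.+2 * K + (r + k)).
pose P l1 n := forall (T : finType) (G : {set T}) (L : seq nat) (A : {set {set T}}),
  n = #|G| -> sorted ltn L -> size L = r -> head 0 L = l1 ->
  (forall X, X \in A -> X \subset G) -> kwise id k L A ->
  r.+1 * #|A| <= (k + r - 1) * 'C(#|G|, r) + r.+1 * (r * #|G|.+1 ^ r.-1).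
have [l1|n0 Pn0] := @exists_uniform_threshold P b.
  have [n0 Hn0] := IHr r0 l1; exists n0 => n leN T G L A Dn Ls sL hL AG kA.
  rewrite Dn in leN; apply: leq_trans (Hn0 T G L A leN Ls sL hL AG kA) _.
  by rewrite leq_add // leq_mul // ?leq_bin2l ?leq_sum_bin ?leq_subr.
exists (n0 + 1 + 2 * r.+1 + W * Q) => T G L A leG Lsort sL hL [l lL rl] AG kA.
set n := #|G| in leG *; set C := 'C(n, r.+1); set M := n.+1 ^ r.
have k1 : 1 < k by apply: ltnW.
have leG' : n0 < n.
  by apply: leq_trans leG; rewrite -addn1 -!addnA leq_add2l leq_addr.
have Q0 : 0 < Q by rewrite muln_gt0 expn_gt0 fact_gt0.
have leC : n.+1 * M <= Q * C.
  by rewrite -expnS; have := @expn_le_bin n 0 r.+1; rewrite subn0; apply; lia.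
have L0 : 0 \in L by rewrite -hL; case: (L) sL => //= a ? _; rewrite mem_head.
pose A1 := [set X in A | #|X| <= l].
pose A2 := [set X in A | b <= #|X|].
pose A3 := [set X in A | l < #|X| < b].
have A1A : A1 \subset A by apply/subsetP => X; rewrite inE => /andP[].
have A2A : A2 \subset A by apply/subsetP => X; rewrite inE => /andP[].
have A3A : A3 \subset A by apply/subsetP => X; rewrite inE => /andP[].
have cA : #|A| <= #|A1| + #|A2| + #|A3|.
  have : A \subset A1 :|: A2 :|: A3.
    by apply/subsetP => X XA; rewrite !inE XA /= !ltnNge; do 2!case: (_ <= _).
  move=> /subset_leq_card; have := cardsUI (A1 :|: A2) A3.
  by have := cardsUI A1 A2; lia.
(* Distinct members of size at most [l] meet in fewer than [l] points, so [l] leaves the list. *)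
have cA1 : #|A1| <= K * M.
  apply: kwise_card_le k1 _ (fun X XA => AG X (subsetP A1A X XA))
    (kwise_filter_lt (F := id) (l := l) k1 (in2W (fun X Y => id)) _ (kwise_sub A1A kA)).
    by rewrite -ltnS -sL size_filter_lt.
  by move=> X; rewrite inE => /andP[].
(* Members through a point never meet in 0 points, so each degree is at most $KM$. *)
have cA2 : b * #|A2| <= n * (K * M).
  rewrite -[leqLHS]mul1n; apply: mul_card_le_degrees => [X XA|X|x xG].
  - exact: AG (subsetP A2A X XA).
  - by rewrite inE => /andP[].
  rewrite mul1n; set A2x := [set _ in _ | _].
  have A2xA : A2x \subset A.
    by apply: subset_trans A2A; apply/subsetP => X; rewrite inE => /andP[].
  apply: kwise_card_le k1 _ (fun X XA => AG X (subsetP A2xA X XA))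
    (kwise_filter_ge (U := [set x]) _ (kwise_sub A2xA kA)).
    rewrite -ltnS -sL cards1 size_filter -(count_predC (fun x => 0 < x) L).
    by rewrite -addn1 leq_add2l -has_count; apply/hasP; exists 0.
  by move=> X; rewrite inE sub1set => /andP[].
have cA3 : r.+2 * #|A3| <= (k + r - 1) * C + (r + k) * M.
  pose c := (k + r - 1) * 'C(n.-1, r) + r.+1 * (r * n.+1 ^ r.-1 + k).
  have deg x : x \in G -> r.+1 * #|[set X in A3 | x \in X]| <= c.
    move=> xG; set A3x := [set _ in _ | _].
    have A3xA3 : A3x \subset A3 by apply/subsetP => X; rewrite inE => /andP[].
    have A3xx X : X \in A3x -> [set x] \subset X.
      by rewrite inE sub1set => /andP[].
    (* Fewer than [k] members say nothing about the list; the summand [k] in [c] covers them. *)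
    have [ltk|lek] := ltnP #|A3x| k.
      by apply: leq_trans (leq_addl _ _); rewrite leq_mul // ltnW // ltn_addl.
    rewrite -(card_link A3xx) in lek *; set A' := imset _ _ in lek *.
    pose L' := [seq l - 1 | l <- behead L].
    have L'sort : sorted ltn L'.
      move: Lsort hL; rewrite /L'; case: (L) => //= a L1 aL1 a0.
      apply: sorted_map_sub; last exact: path_sorted aL1.
      by rewrite -a0; apply: order_path_min aL1; apply: ltn_trans.
    have kA' : kwise id k L' A'.
      apply: (@kwise_link _ _ L) => //; first exact: ltnW.
        rewrite cards1 => y yL y0; apply: map_f; move: yL hL.
        by case: (L) => //= a L1; rewrite inE => /predU1P[ya a0|//]; rewrite ya a0 in y0.
      exact: kwise_sub (subset_trans A3xA3 A3A) kA.
    (* Some [k] members of the link exist, and their intersection, of size below [b], bounds the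
       least value of [L']. *)
    have hL' : head 0 L' < b.
      have [|B [_ BA' cB]] := @card_extend _ A' set0 k (sub0set _).
        by rewrite cards0.
      apply: leq_ltn_trans (head_leq L'sort (kA' B BA' cB)) _.
      have [Y YB] : exists Y, Y \in B by apply/set0Pn; rewrite -card_gt0 cB ltnW.
      have /imsetP[X XA3x YE] := subsetP BA' Y YB.
      have := subsetP A3xA3 X XA3x; rewrite inE => /and3P[_ _]; apply: leq_ltn_trans.
      apply: subset_leq_card; apply: subset_trans (bigcap_inf Y YB) _.
      by rewrite YE subsetDl.
    have cGx : #|G :\ x| = n.-1 by rewrite /n (cardsD1 x G) xG.
    have := Pn0 _ n.-1 hL' _ T (G :\ x) L' A' _ L'sort _ erefl _ kA'.
    rewrite cGx; move=> /(_ _ erefl _ _)/leq_trans; apply.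
    - by rewrite -ltnS (ltn_predK leG').
    - by rewrite size_map size_behead sL.
    - move=> _ /imsetP[X /(subsetP A3xA3)/(subsetP A3A)/AG XG ->].
      exact: setSD.
    rewrite leq_add2l leq_mul // (leq_trans _ (leq_addr _ _)) // leq_mul //.
    by case: (r.-1) => // e; rewrite leq_exp2r // ltnS leq_pred.
  have A3r X : X \in A3 -> r.+2 <= #|X|.
    by rewrite inE => /and3P[_ lX _]; apply: leq_ltn_trans lX.
  have := mul_card_le_degrees (fun X XA => AG X (subsetP A3A X XA)) A3r deg.
  move=> le3; rewrite -(leq_pmul2l (ltn0Sn r)); apply: leq_trans le3 _.
  (* The factor $r+1$ cancels here: the denominator rises to $r+2$ while the numerator stays
     $k+r-1$, one below the target. *)
  have nC : n * 'C(n.-1, r) = r.+1 * C by apply: mul_bin_diag.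
  have nM : n * n.+1 ^ r.-1 <= M by rewrite /M -[in leqRHS](prednK r0) expnS leq_mul.
  have nM' : n <= M.
    by apply: leq_trans (leqnSn n) _; rewrite -{1}[n.+1]expn1 leq_pexp2l.
  have -> : n * c = r.+1 * ((k + r - 1) * C + (r * (n * n.+1 ^ r.-1) + k * n)).
    rewrite mulnDr [r.+1 * (_ * C)]mulnCA -nC /c.
    by move: (k + r - 1) ('C(_, _)) (_ ^ _) => kr c0 e; ring.
  by rewrite leq_mul2l leq_add2l mulnDl leq_add // leq_mul2l ?nM ?nM' ?orbT.
have cA2' : 2 * (r.+2 * #|A2|) <= C.
  have KQ0 : 0 < K * Q by rewrite muln_gt0 Q0 andbT /K muln_gt0 ltnW.
  rewrite -(leq_pmul2l KQ0).
  have -> : K * Q * (2 * (r.+2 * #|A2|)) = b * #|A2| by rewrite /b; ring.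
  apply: leq_trans cA2 _; rewrite mulnCA -mulnA leq_mul2l; apply/orP; right.
  by apply: leq_trans leC; rewrite leq_mul.
have leM : W * M <= C.
  rewrite -(leq_pmul2l Q0); apply: leq_trans leC; rewrite mulnA leq_mul2r.
  by apply/orP; right; rewrite mulnC; lia.
(* The spare copy of [C] pays one half for [A2] and one half for the terms of order $n^r$. *)
have -> : k + r = (k + r - 1).+1 by lia.
apply: leq_trans (leq_mul (leqnn _) cA) _.
rewrite !mulnDr mulSn.
have := leq_mul (leqnn r.+2) cA1.
move: leM cA3; rewrite /W -mulnA mulnDl -mulnA.
lia.
Qed.

(** * Induction on s and the final bound *)

Lemma card_bound_eventuallyP (k s l1 : nat) :
  2 < k -> 0 < s -> card_bound_eventually k s l1.
Proof.
move=> k2; elim: s l1 => // r IHr l1 _.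
have [n1 no_core] := no_core_card l1 k2 (ltn0Sn r).
have [n2 no_interval] := card_not_interval k2 (fun r0 l => IHr l r0).
(* The summand [l1] leaves at least [n2] points once the common set is deleted. *)
exists (n1 + n2 + l1) => T G L A leG Lsort sL hL AG kA.
have Ll1 l : l \in L -> l1 <= l by rewrite -hL; apply: head_leq.
have l1L : l1 \in L by rewrite -hL; case: (L) sL => //= a L1 _; rewrite mem_head.
have [/existsP[D /andP[/eqP cD /forall_inP AD]]|nocoreA] :=
    boolP [exists D : {set T}, (#|D| == l1) && [forall X in A, D \subset X]]; last first.
  have leA : #|A| <= 'C(#|G| - l1, r.+1).
    apply: no_core (sL) l1L Ll1 AG kA _; first by lia.
    move=> D cD; move: nocoreA; rewrite negb_exists => /forallP/(_ D).
    by rewrite cD eqxx negb_forall_in => /exists_inP.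
  (* The coefficient is at least 1, since $s+1\le k+s-1$. *)
  apply: leq_trans (leq_addr _ _); apply: leq_mul leA; lia.
have [->|[X0 X0A]] := set_0Vmem A; first by rewrite cards0 muln0.
have DG : D \subset G := subset_trans (AD X0 X0A) (AG X0 X0A).
have cGD : #|G :\: D| = #|G| - l1 by rewrite cardsD (setIidPr DG) cD.
rewrite -(card_link AD) -cGD; set A' := imset _ _; pose L' := [seq l - l1 | l <- L].
have AG' X : X \in A' -> X \subset G :\: D by move=> /imsetP[Y /AG YG ->]; apply: setSD.
have kA' : kwise id k L' A'.
  apply: (@kwise_link _ _ L) => //; first by lia.
  by move=> l lL _; rewrite cD; apply: (map_f (subn^~ l1)).
have [L'r|] := boolP (all (fun l => l < r.+1) L').
  by apply: card_interval AG' kA'; [lia | apply/allP].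
rewrite -has_predC => /hasP[l lL' /=]; rewrite -leqNgt => rl.
apply: leq_trans (leq_addr _ _); rewrite addnS subn1.
apply: (no_interval _ _ L') AG' kA'; last by exists l.
- by rewrite cGD; lia.
- by apply: sorted_map_sub; first apply/allP.
- by rewrite size_map.
- by move: hL; rewrite /L'; case: (L) => //= a _ ->; apply: subnn.
Qed.

Local Open Scope ring_scope.

Theorem theorem1p10 (k s l1 : nat) (hk : (3 <= k)%N) (hs : (0 < s)%N) :
  exists n0 : nat, forall n : nat, (n0 <= n)%N ->
  forall L : seq nat, sorted ltn L -> size L = s -> head 0%N L = l1 ->
  forall A : {set {set 'I_n}}, kwise_intersecting k L A ->
  (#|A|%:R : rat) <=
    (k + s - 1)%N%:R / (s + 1)%N%:R * 'C(n - l1, s)%:R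
    + \sum_(i < s) 'C(n - l1, i)%:R.
Proof.
have [n0 bound] := card_bound_eventuallyP l1 hk hs.
exists n0 => n leN L Lsort sL hL A kA.
have cT : #|[set: 'I_n]| = n by rewrite cardsT card_ord.
have := bound _ [set: 'I_n] L A _ Lsort sL hL (fun X _ => subsetT X) kA.
rewrite cT => /(_ leN); rewrite -natr_sum addn1 -(ler_nat rat) natrD !natrM => le_sA.
have s1 : 0 < s.+1%:R :> rat by rewrite ltr0n.
by rewrite -(ler_pM2l s1) mulrDr mulrA [_ * (_ / _)]mulrCA divff ?gt_eqF // mulr1.
Qed.
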